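(* Let $T$ be a tree. The differentiation operator $D$ on the Lipschitz space $\mathcal{L}(T)$ has operator norm $2$.
   Context: A tree $T$ is a locally finite, connected, simply-connected graph, identified with its set of vertices. A vertex is terminal if it has a unique neighbor; all trees are assumed to be without terminal vertices (hence infinite) and rooted at a vertex $o$; $T^*=T\setminus\{o\}$. For $v\neq o$, $v^-$ denotes the unique neighbor of $v$ lying on the path from $o$ to $v$ (the parent of $v$). The derivative of $f:T\to\mathbb{C}$ is $f'(v)=f(v)-f(v^-)$ for $v\neq o$ and $f'(o)=0$; the differentiation operator is $Df=f'$. The Lipschitz space $\mathcal{L}(T)$ is the set of all $f:T\to\mathbb{C}$ with $\sup_{v\in T^*}|f'(v)|<\infty$; it is a Banach space under the norm $\|f\|_{\mathcal{L}}=|f(o)|+\sup_{v\in T^*}|f'(v)|$. $D$ is considered as an operator from $\mathcal{L}(T)$ to $\mathcal{L}(T)$ (it is bounded). *)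

(* Defs.v *)
From HB Require Import structures.
From mathcomp Require Import all_boot all_order all_algebra.
From mathcomp Require Import all_classical all_reals all_analysis.
From mathcomp Require Import complex.

Set Implicit Arguments.
Unset Strict Implicit.
Unset Printing Implicit Defensive.

Import Order.TTheory GRing.Theory Num.Theory.
Import numFieldNormedType.Exports.

Local Open Scope classical_set_scope.
Local Open Scope ring_scope.
Local Open Scope complex_scope.

(* A cycle of size 2 is an edge traversed back and forth, so a circuit of a
   simple graph has at least 3 vertices; a connected graph is simply connected
   iff it has no circuit.  [tree_infinite] only excludes the one-vertex tree,
   whose vertex has no neighbor and is thus not terminal. *)
Record tree := Tree {
  vertex :> choiceType;
  adj : rel vertex;
  tree_root : vertex;
  adj_sym : symmetric adj;
  adj_irrefl : irreflexive adj;
  tree_locally_finite : forall v, finite_set [set w | adj v w];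
  tree_connected : forall u v, exists2 p, path adj u p & last u p = v;
  tree_acyclic : forall c, ucycle adj c -> (size c <= 2)%N;
  tree_no_terminal : forall v, ~ (exists! w, adj v w);
  tree_infinite : infinite_set [set: vertex]
}.

Arguments adj {t}.
Arguments tree_root {t}.

Section Parent.
Variable T : tree.
Implicit Types (u v w : T) (p : seq T).

Definition simple_path u p v :=
  [/\ path adj u p, uniq (u :: p) & last u p = v].

Definition is_parent w v :=
  adj w v /\ exists2 p, simple_path tree_root p v & w \in tree_root :: p.

(* A parent is unique ([is_parent_uniq]); the default value of [xget] is only
   reached at the root, where [tderiv] does not use it. *)
Definition parent v : T := xget tree_root [set w | is_parent w v].

Lemma simple_path_exists v : exists p, simple_path tree_root p v.
Proof.
have [p pp lp] := tree_connected tree_root v.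
by case/shortenP: pp lp => q pq uq _ lq; exists q.
Qed.

Lemma is_parent_avoid w v : is_parent w v ->
  exists p, [/\ path adj tree_root p, last tree_root p = w &
                v \notin tree_root :: p].
Proof.
move=> [wv [p [pp up lp] wp]].
case/splitPl: wp pp up lp => p1 p2 l1.
rewrite cat_path last_cat l1 => /andP[pp1 _].
rewrite -cat_cons cat_uniq => /and3P[_ /hasPn h _] lp2.
exists p1; split => //; apply: (h v).
case: p2 lp2 {h} => [/= wvE|x p2 /= <-]; last exact: mem_last.
by move: wv; rewrite wvE adj_irrefl.
Qed.

Lemma is_parent_uniq w w' v : is_parent w v -> is_parent w' v -> w = w'.
Proof.
move=> hw hw'; apply/eqP; apply: contraT => ww'.
have [p [pp lp vp]] := is_parent_avoid hw.
have [p' [pp' lp' vp']] := is_parent_avoid hw'.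
pose q := rev (belast tree_root p) ++ p'.
have pq : path adj w q.
  rewrite cat_path -{1}lp rev_path.
  rewrite (eq_path (e' := adj)) ?pp//=; last by move=> x y; rewrite adj_sym.
  suff -> : last w (rev (belast tree_root p)) = tree_root by [].
  by case: (p) lp => //= x s _; rewrite rev_cons last_rcons.
have lq : last w q = w'.
  rewrite last_cat -lp'; congr last.
  by case: (p) lp => //= x s _; rewrite rev_cons last_rcons.
have vq : v \notin w :: q.
  rewrite inE mem_cat mem_rev !negb_or; apply/and3P; split.
  - by apply: contraNneq vp => ->; rewrite -lp mem_last.
  - by apply: contra vp => /mem_belast.
  - by apply: contra vp'; rewrite inE => ->; rewrite orbT.
case/shortenP: pq lq => s ps us sq lsE.
have vs : v \notin w :: s.
  apply: contra vq; rewrite !inE => /orP[->//|vs].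
  by rewrite sq ?orbT.
have : ucycle adj [:: v, w & s].
  apply/andP; split; last by rewrite cons_uniq vs us.
  rewrite /= rcons_path ps lsE adj_sym hw.1 /=.
  exact: hw'.1.
move/tree_acyclic; case: s lsE {ps us sq vs} => //= ww'E.
by rewrite ww'E eqxx in ww'.
Qed.

Lemma parentE w v : is_parent w v -> parent v = w.
Proof.
move=> wv; apply: (is_parent_uniq (v := v)) => //.
exact: (@xgetPex _ tree_root [set w | is_parent w v]) (ex_intro _ w wv).
Qed.

Lemma rcons_is_parent p v :
  simple_path tree_root (rcons p v) v -> is_parent (last tree_root p) v.
Proof.
move=> hp; split; last first.
  by exists (rcons p v) => //; rewrite -rcons_cons mem_rcons inE mem_last orbT.
by case: hp; rewrite rcons_path => /andP[].
Qed.

Lemma tree_induction (P : T -> Prop) : P tree_root ->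
  (forall v, v != tree_root -> P (parent v) -> P v) -> forall v, P v.
Proof.
move=> P0 IH v; have [p] := simple_path_exists v.
elim/last_ind: p v => [|p w IHp] v hp; first by case: hp => _ _ <-.
have wv : w = v by case: hp; rewrite last_rcons.
subst w; have hv := rcons_is_parent hp.
case: (hp); rewrite rcons_path -rcons_cons rcons_uniq.
move=> /andP[pp _] /andP[vp up] _.
apply: IH; last by rewrite (parentE hv); apply: IHp; split.
by apply: contraNneq vp => ->; rewrite mem_head.
Qed.

Lemma nonroot_exists : exists v : T, v != tree_root.
Proof.
apply: contrapT => h; apply: (@tree_infinite T).
apply: (@sub_finite_set _ _ [set tree_root]); last exact: finite_set1.
by move=> v _; apply: contrapT => /eqP v0; apply: h; exists v.
Qed.

End Parent.

Section Lipschitz.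
Variables (R : realType) (T : tree).
Implicit Types (f g : T -> R[i]) (v : T) (a : R[i]).

(* [`|z|] is R[i]-valued; the real-valued modulus is [Normc.normc]. *)
Local Notation normc := (@Normc.normc R).

Lemma normc_ge0 a : 0 <= normc a.
Proof. by case: a => x y; exact: Num.Theory.sqrtr_ge0. Qed.

Definition tderiv f v : R[i] :=
  if v == tree_root then 0 else f v - f (parent v).

Lemma tderiv_is_linear : linear tderiv.
Proof.
move=> a f g; apply/funext => v; rewrite /tderiv !fctE.
by case: eqP => _; [rewrite scaler0 addr0|rewrite scalerBr opprD addrACA].
Qed.

Lemma tderiv_linear a f g v :
  tderiv (a *: f + g) v = a * tderiv f v + tderiv g v.
Proof. by rewrite tderiv_is_linear. Qed.

Definition tderiv_moduli f : set R :=
  [set normc (tderiv f v) | v in [set v | v != tree_root]].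

Definition is_lipschitz f := has_ubound (tderiv_moduli f).

Lemma tderiv_moduli_neq0 f : tderiv_moduli f !=set0.
Proof. by have [v v0] := nonroot_exists T; exists (normc (tderiv f v)), v. Qed.

Lemma sup_moduli_ge0 f : is_lipschitz f -> 0 <= sup (tderiv_moduli f).
Proof.
move=> hf; have [x fx] := tderiv_moduli_neq0 f.
apply: (@le_trans _ _ x); first by case: fx => v _ <-; exact: normc_ge0.
exact: ub_le_sup.
Qed.

Lemma le_sup_moduli f v : is_lipschitz f ->
  normc (tderiv f v) <= sup (tderiv_moduli f).
Proof.
move=> hf; have [->|v0] := eqVneq v tree_root.
  by rewrite /tderiv eqxx Normc.normc0 sup_moduli_ge0.
by apply: ub_le_sup => //; exists v.
Qed.

Lemma sup_moduli_le f M :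
  (forall v, v != tree_root -> normc (tderiv f v) <= M) ->
  sup (tderiv_moduli f) <= M.
Proof.
move=> h; apply: ge_sup; first exact: tderiv_moduli_neq0.
by move=> _ [v v0 <-]; exact: h.
Qed.

Definition lipschitz_pred : {pred T -> R[i]} := mem [set f | is_lipschitz f].

Lemma lipschitz_predP f : reflect (is_lipschitz f) (f \in lipschitz_pred).
Proof. by apply: (iffP idP) => [/set_mem|/mem_set]. Qed.

Lemma lipschitz_submod_closed : submod_closed lipschitz_pred.
Proof.
split=> [|a f g /lipschitz_predP hf /lipschitz_predP hg]; apply/lipschitz_predP.
  exists 0 => _ [v /= v0 <-].
  by rewrite /tderiv (negPf v0) subrr Normc.normc0.
exists (normc a * sup (tderiv_moduli f) + sup (tderiv_moduli g)) => _ [v v0 <-].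
rewrite tderiv_linear (le_trans (le_normcD _ _))// Normc.normcM.
by rewrite lerD// ?ler_wpM2l ?normc_ge0// le_sup_moduli.
Qed.

HB.instance Definition _ := GRing.isSubmodClosed.Build R[i] (T -> R[i])
  lipschitz_pred lipschitz_submod_closed.

Record lipschitz_space := Lipschitz {
  lipschitz_fun :> T -> R[i];
  lipschitz_funP : lipschitz_fun \in lipschitz_pred
}.

HB.instance Definition _ := [isSub for lipschitz_fun].
HB.instance Definition _ := [Choice of lipschitz_space by <:].
HB.instance Definition _ := [SubChoice_isSubLmodule of lipschitz_space by <:].

Definition lipschitz_norm (f : lipschitz_space) : R :=
  normc (f tree_root) + sup (tderiv_moduli f).

Lemma lipschitzP (f : lipschitz_space) : is_lipschitz f.
Proof. exact/lipschitz_predP/lipschitz_funP. Qed.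

(* The norm of a module normed over R[i] takes its values in R[i]. *)
Definition lipschitz_normC (f : lipschitz_space) : R[i] :=
  (lipschitz_norm f)%:C.

Lemma lipschitz_normD (f g : lipschitz_space) :
  lipschitz_normC (f + g) <= lipschitz_normC f + lipschitz_normC g.
Proof.
rewrite /lipschitz_normC -rmorphD lecR addrACA lerD ?le_normcD//.
apply: sup_moduli_le => v v0.
rewrite -[lipschitz_fun (f + g)]/((f : T -> R[i]) + (g : T -> R[i])).
rewrite -[X in X + _]scale1r.
rewrite tderiv_linear mul1r (le_trans (le_normcD _ _))// lerD// le_sup_moduli//;
  exact: lipschitzP.
Qed.

Lemma sup_moduliZ_le a f : is_lipschitz f ->
  sup (tderiv_moduli (a *: f)) <= normc a * sup (tderiv_moduli f).
Proof.
move=> hf; apply: sup_moduli_le => v v0.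
rewrite -[a *: f]addr0 tderiv_linear {2}/tderiv (negPf v0) subrr addr0.
by rewrite Normc.normcM ler_wpM2l ?normc_ge0// le_sup_moduli.
Qed.

Lemma lipschitz_normZ a (f : lipschitz_space) :
  lipschitz_normC (a *: f) = `|a| * lipschitz_normC f.
Proof.
have -> : `|a| = (normc a)%:C by case: a.
rewrite /lipschitz_normC -rmorphM /lipschitz_norm mulrDr.
rewrite -[lipschitz_fun (a *: f)]/(a *: (f : T -> R[i])).
rewrite -Normc.normcM; congr (_ + _)%:C.
apply/eqP; rewrite eq_le sup_moduliZ_le/=; last exact: lipschitzP.
have [->|a0] := eqVneq a 0.
  rewrite Normc.normc0 mul0r sup_moduli_ge0//.
  rewrite -[_ *: _]/(lipschitz_fun (0 *: f)).
  exact: lipschitzP.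
have na0 : 0 < normc a.
  by rewrite lt_def normc_ge0 andbT; apply: contra_neq a0 => /Normc.eq0_normc.
rewrite mulrC -ler_pdivlMr// mulrC -Normc.normcV.
rewrite -{1}[lipschitz_fun f]scale1r -(mulVf a0) -scalerA.
apply: sup_moduliZ_le; rewrite -[_ *: _]/(lipschitz_fun (a *: f)).
exact: lipschitzP.
Qed.

Lemma lipschitz_norm_eq0 (f : lipschitz_space) : lipschitz_normC f = 0 -> f = 0.
Proof.
move=> /complexI f0; have s0 := sup_moduli_ge0 (lipschitzP f).
have n0 := normc_ge0 (f tree_root).
move/eqP: f0; rewrite paddr_eq0// => /andP[/eqP/Normc.eq0_normc fo /eqP fs].
apply/val_inj/funext; apply: tree_induction => [|v v0 IH]; first exact: fo.
have := le_sup_moduli v (lipschitzP f); rewrite fs => h.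
have /Normc.eq0_normc : normc (tderiv f v) = 0.
  by apply/eqP; rewrite eq_le h normc_ge0.
by rewrite /tderiv (negPf v0) => /eqP; rewrite subr_eq0 => /eqP fv;
  exact: etrans fv IH.
Qed.

HB.instance Definition _ := Lmodule_isNormed.Build R[i] lipschitz_space
  lipschitz_normD lipschitz_normZ lipschitz_norm_eq0.

Lemma lipschitz_normE (f : lipschitz_space) :
  `|f| = (normc (f tree_root) + sup (tderiv_moduli f))%:C.
Proof. by []. Qed.

Lemma tderiv_lipschitz (f : lipschitz_space) : tderiv f \in lipschitz_pred.
Proof.
apply/lipschitz_predP; have hf := lipschitzP f.
exists (sup (tderiv_moduli f) + sup (tderiv_moduli f)) => _ [v v0 <-].
rewrite [X in normc X]/tderiv (negPf v0) (le_trans (le_normcD _ _))// normcN.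
by rewrite lerD// le_sup_moduli.
Qed.

Definition diff_op (f : lipschitz_space) : lipschitz_space :=
  Lipschitz (tderiv_lipschitz f).

Lemma diff_op_is_linear : linear diff_op.
Proof. by move=> a f g; apply/val_inj; exact: tderiv_is_linear. Qed.

HB.instance Definition _ := GRing.isLinear.Build R[i]
  lipschitz_space lipschitz_space _ diff_op diff_op_is_linear.

End Lipschitz.

(* The norm on a complex normed space is R[i]-valued with zero imaginary part;
   the operator norm is +oo for an unbounded operator. *)
Definition opnorm (R : realType) (U V : normedModType R[i])
    (A : {linear U -> V}) : \bar R :=
  ereal_sup [set (complex.Re `|A x|)%:E | x in [set x | `|x| <= 1]].

(* Main.v *)
Require Import Defs.
From mathcomp Require Import all_boot all_order all_algebra.
From mathcomp Require Import all_classical all_reals all_analysis.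
From mathcomp Require Import complex.

(** The function [D f] vanishes at the root, so its norm is the supremum of
    [|f'(v) - f'(v^-)|] over the nonroot vertices, which the triangle
    inequality bounds by twice the Lipschitz constant of [f]; hence the operator
    norm is at most 2 ([lipschitz_norm_diff_op_le]).

    The bound is attained by the indicator of any nonroot vertex [v].  Its
    derivative is 1 at [v], -1 at the children of [v] and 0 elsewhere, so it
    has norm at most 1 ([lipschitz_norm_vertex_indic_le1]), while at a child
    [w] of [v] the second derivative is [-1 - 1 = -2].  Such a child exists
    because the tree has no terminal vertex ([child_exists]). *)

Set Implicit Arguments.
Unset Strict Implicit.
Unset Printing Implicit Defensive.

Import Order.TTheory GRing.Theory Num.Theory.

Local Open Scope classical_set_scope.
Local Open Scope ring_scope.
Local Open Scope complex_scope.

Section Children.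
Variable T : tree.
Implicit Types v w : T.

Lemma is_parent_parent v : v != tree_root -> is_parent (parent v) v.
Proof.
move=> v0; have [p] := simple_path_exists v.
case/lastP: p => [[_ _ /= vE]|p w hp]; first by rewrite -vE eqxx in v0.
have wv : w = v by case: hp; rewrite last_rcons.
subst w; have hv := rcons_is_parent hp.
by rewrite (parentE hv).
Qed.

Lemma parent_neq v : v != tree_root -> parent v != v.
Proof.
move=> /is_parent_parent[pv _].
by apply: contraTneq pv => ->; rewrite adj_irrefl.
Qed.

(** As [v] is not terminal, it has a neighbor [w] other than its parent.  The
    simple path from the root to [v] avoids [w], since a neighbor of [v] on
    that path is by definition the parent of [v]; extended by [w], the path is
    therefore still simple, and [v] comes just before [w] on it. *)
Lemma child_exists v : v != tree_root ->
  exists2 w, w != tree_root & parent w = v.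
Proof.
move=> v0; have hv := is_parent_parent v0.
have [w vw wv] : exists2 w, adj v w & w != parent v.
  apply: contrapT => h; apply: (@tree_no_terminal T v).
  exists (parent v); split; first by rewrite adj_sym hv.1.
  move=> w vw; apply/esym/eqP; apply: contraT => wv.
  by case: h; exists w.
have [p hp] := simple_path_exists v.
have wp : w \notin tree_root :: p.
  apply: contra wv => wp; apply/eqP/esym/parentE; split; last by exists p.
  by rewrite adj_sym.
exists w; first by apply: contraNneq wp => ->; rewrite mem_head.
case: hp => pp up lp; rewrite -[RHS]lp; apply/parentE/rcons_is_parent; split.
- by rewrite rcons_path pp lp.
- by rewrite -rcons_cons rcons_uniq wp up.
- by rewrite last_rcons.
Qed.

End Children.

Section OperatorNorm.
Variables (R : realType) (T : tree).
Implicit Types (f : lipschitz_space R T) (u v w : T).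

Local Notation normc := (@Normc.normc R).

Lemma lipschitz_norm_diff_op_le f :
  lipschitz_norm (diff_op f) <= 2 * lipschitz_norm f.
Proof.
have hf := lipschitzP f.
rewrite {1}/lipschitz_norm /= {1}/tderiv eqxx Normc.normc0 add0r.
apply: (@le_trans _ _ (2 * sup (tderiv_moduli f))); last first.
  by rewrite ler_wpM2l// /lipschitz_norm lerDr normc_ge0.
apply: sup_moduli_le => v v0.
rewrite [X in normc X]/tderiv (negPf v0) (le_trans (le_normcD _ _))// normcN.
by rewrite mulr_natl mulr2n lerD// le_sup_moduli.
Qed.

Definition vertex_indic_fun v : T -> R[i] := fun u => (u == v)%:R.

Lemma normc_tderiv_vertex_indic v u :
  normc (tderiv (vertex_indic_fun v) u) <= 1.
Proof.
rewrite /tderiv /vertex_indic_fun; case: ifP => _; first by rewrite Normc.normc0.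
by do 2 case: eqP => _;
  rewrite ?subrr ?subr0 ?sub0r ?normcN ?Normc.normc0 ?Normc.normc1.
Qed.

Lemma vertex_indic_lipschitz v :
  vertex_indic_fun v \in @lipschitz_pred R T.
Proof.
apply/lipschitz_predP; exists 1 => _ [u _ <-].
exact: normc_tderiv_vertex_indic.
Qed.

Definition vertex_indic v : lipschitz_space R T :=
  Lipschitz (vertex_indic_lipschitz v).

Lemma lipschitz_norm_vertex_indic_le1 v : v != tree_root ->
  lipschitz_norm (vertex_indic v) <= 1.
Proof.
move=> v0; rewrite /lipschitz_norm /= /vertex_indic_fun eq_sym (negPf v0).
rewrite Normc.normc0 add0r; apply: sup_moduli_le => u _.
exact: normc_tderiv_vertex_indic.
Qed.

Lemma lipschitz_norm_diff_op_vertex_indic v : v != tree_root ->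
  2 <= lipschitz_norm (diff_op (vertex_indic v)).
Proof.
move=> v0; have [w w0 wv] := child_exists v0.
have := le_sup_moduli w (lipschitzP (diff_op (vertex_indic v))).
have -> : tderiv (diff_op (vertex_indic v)) w = - (2%:R).
  rewrite /tderiv /= /tderiv (negPf w0) wv (negPf v0) /vertex_indic_fun.
  rewrite eqxx (negPf (parent_neq v0)) -{1}wv eq_sym (negPf (parent_neq w0)).
  by rewrite sub0r subr0 -opprD.
(* Seen as the image of a real, 2 unfolds to a pair with zero imaginary part. *)
rewrite normcN -[2%:R](rmorph_nat (@real_complex R)).
rewrite /= expr0n /= addr0 sqrtr_sqr ger0_norm// => h.
by rewrite (le_trans h)// lerDr normc_ge0.
Qed.

End OperatorNorm.

Theorem theorem3p2 (R : realType) (T : tree) :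
  opnorm (@diff_op R T) = 2%:E.
Proof.
apply/eqP; rewrite eq_le; apply/andP; split.
  apply: ge_ereal_sup => _ [f /= f1 <-].
  have {}f1 : lipschitz_norm f <= 1 by rewrite -lecR.
  rewrite lee_fin (le_trans (lipschitz_norm_diff_op_le f))//.
  by rewrite -[leRHS]mulr1 ler_wpM2l.
have [v v0] := nonroot_exists T.
apply: le_trans (ereal_sup_ubound _); last first.
  exists (vertex_indic R v) => //=.
  have := lipschitz_norm_vertex_indic_le1 R v0.
  by rewrite -lecR.
by rewrite lee_fin; exact: lipschitz_norm_diff_op_vertex_indic.
Qed.
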